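(* Let $\mathfrak{X}$ be the complex Banach space of all functions $f:[0,1]\to\mathbb{C}$ with $\|f\|_1=\sum_{x\in[0,1]}|f(x)|<\infty$, let $\mathfrak{M}=C[0,1]$ be the space of continuous functions $g:[0,1]\to\mathbb{C}$, and consider the dual pair $(\mathfrak{X},\mathfrak{M})$ with pairing $\langle f,g\rangle=\sum_{x\in[0,1]}f(x)g(x)$. Let $E$ be the locally convex space $\mathfrak{X}$ endowed with the Mackey topology $\tau(\mathfrak{X},\mathfrak{M})$, so that $E^*=\mathfrak{M}$, and let $\mathcal{C}=\{f\in\mathfrak{X}:\|f\|_1\le 1\}$. Then $\mathcal{C}\subset E$ is not $\sigma(E,E^* )$-compact.
   Context: The Mackey topology $\tau(\mathfrak{X},\mathfrak{M})$ is the finest locally convex topology on $\mathfrak{X}$ whose continuous dual is $\mathfrak{M}$ (each $g\in\mathfrak{M}$ being identified with the functional $f\mapsto\langle f,g\rangle$). Here $\sigma(E,E^* )=\sigma(\mathfrak{X},\mathfrak{M})$ is the coarsest topology on $\mathfrak{X}$ making all functionals $f\mapsto\sum_{x\in[0,1]}f(x)g(x)$, $g\in C[0,1]$, continuous. *)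

(* Defs.v *)
From HB Require Import structures.
From mathcomp Require Import all_boot all_order all_algebra.
From mathcomp Require Import complex.
From mathcomp Require Import all_classical all_reals all_analysis.
From mathcomp.analysis Require showcase.summability.

Set Implicit Arguments.
Unset Strict Implicit.
Unset Printing Implicit Defensive.

Import Order.TTheory GRing.Theory Num.Theory.
Import numFieldNormedType.Exports.

Local Open Scope classical_set_scope.
Local Open Scope ring_scope.

Section LocallyConvexTopologies.
Context {K : numFieldType} {V : lmodType K}.

(* A topology on the vector space V is given as a [Topological] structure on its
   carrier; [Topological.Pack t] is the corresponding topological space.  The
   three clauses are those of the factory [PreTopologicalLmod_isTvs].  Over
   complex scalars, the coefficients in [convex_set] range over the k : K with
   0 <= k <= 1, that is, over the real unit interval. *)
Definition locally_convex_topology (t : Topological V) : Prop :=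
  let E : topologicalType := Topological.Pack t in
  [/\ continuous (fun x : E * E => (x.1 : V) + (x.2 : V) : E),
      continuous (fun z : K^o * E => z.1 *: (z.2 : V) : E) &
      exists2 B : set_system E,
        (forall b, b \in B -> @convex_set K V b) & basis B].

Definition continuous_dual (t : Topological V) : set (V -> K^o) :=
  [set l | linear l /\ continuous (l : Topological.Pack t -> K^o)].

Definition finer_topology (t t' : Topological V) : Prop :=
  @open (Topological.Pack t') `<=` @open (Topological.Pack t).

(* In a dual pair the second space is represented by the set D of functionals
   that it induces on V. *)
Definition is_mackey_topology (D : set (V -> K^o)) (t : Topological V) : Prop :=
  [/\ locally_convex_topology t,
      continuous_dual t = D &
      forall t' : Topological V, locally_convex_topology t' ->
        continuous_dual t' = D -> finer_topology t t'].

(* The coarsest topology on V making all the functionals in D continuous. *)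
Definition weak_topology (D : set (V -> K^o)) : topologicalType :=
  sup_topology (fun l : D =>
    Topological.class (initial_topology (val l : V -> K^o))).

End LocallyConvexTopologies.

Section L1.
Context (R : realType).
Local Notation C := R[i].
Local Notation unit_interval := (set_type `[0%R : R, 1%R]%classic).

(* [set_type] carries the subspace topology of R; [Normc.normc] is the modulus as
   an element of R (the norm `|z| of R[i] has values in R[i]). *)
Definition norm1 (f : unit_interval -> C) : \bar R :=
  (\esum_(x in [set: unit_interval]) (Normc.normc (f x))%:E)%E.

Definition l1_pred : {pred unit_interval -> C} :=
  [pred f | (norm1 f < +oo)%E].

Lemma l1_submod_closed : submod_closed l1_pred.
Proof.
have nc0 (z : C) : 0 <= Normc.normc z by case: z => a b; exact: sqrtr_ge0.
have nE (f : unit_interval -> C) x : (0 <= (Normc.normc (f x))%:E)%E.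
  by rewrite lee_fin.
split=> [|a f g].
  rewrite inE /norm1 esum1 ?ltry// => x _ /=.
  by congr EFin; exact: Normc.normc0.
rewrite !inE => fy gy.
have afy : (norm1 (a *: f) <= (Normc.normc a)%:E * norm1 f)%E.
  apply: ge_ereal_sup => _ [A [finA _] <-].
  rewrite (_ : (\sum_(x \in A) (Normc.normc ((a *: f) x))%:E)%E =
    (\sum_(x \in A) ((Normc.normc a)%:E * (Normc.normc (f x))%:E))%E); last first.
    by apply: eq_fsbigr => x _; rewrite -EFinM -Normc.normcM.
  rewrite -ge0_mule_fsumr//; apply: lee_wpmul2l; first by rewrite lee_fin.
  by apply: esum_ge; exists A.
have : ((Normc.normc a)%:E * norm1 f + norm1 g < +oo)%E.
  by rewrite lte_add_pinfty// lte_mul_pinfty// lee_fin.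
apply: le_lt_trans; apply: (le_trans _ (leeD2r _ afy)).
rewrite /norm1 -esumD//; apply: le_esum => x _.
by rewrite -EFinD lee_fin; exact: le_normcD.
Qed.

HB.instance Definition _ :=
  GRing.isSubmodClosed.Build C (unit_interval -> C) l1_pred l1_submod_closed.

Record l1 := L1 { l1_fun :> unit_interval -> C; l1P : l1_fun \in l1_pred }.
HB.instance Definition _ := [isSub for l1_fun].
HB.instance Definition _ := [Choice of l1 by <:].
HB.instance Definition _ := [SubChoice_isSubLmodule of l1 by <:].

(* [summability.sum] is the unordered sum: the limit of the partial sums over the
   finite subsets, directed by inclusion. *)
Definition pairing (f : l1) (g : unit_interval -> C) : C^o :=
  summability.sum (fun x => f x * g x : C^o).

Definition C01 : set (unit_interval -> C) :=
  [set g | continuous (g : unit_interval -> C^o)].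

Definition C01_functionals : set (l1 -> C^o) :=
  [set (fun f => pairing f g) | g in C01].

Definition l1_unit_ball : set l1 := [set f : l1 | (norm1 f <= 1)%E].

End L1.

(* Main.v *)
(* The averages m_q of the 2^q point masses at k/2^q lie in the unit ball.  If
   the ball were weakly compact, they would have a weak cluster point f in it, a
   substitute for Lebesgue measure in l^1.  Testing against the constant 1 gives
   <f,1> = 1, so f(x) <> 0 for some x.  Test now against the tent function g_p of
   height 1 and half-width 2^-p centered at x.  For large p, <f,g_p> is close to
   f(x), because f is summable; but <m_q,g_p> <= 2/2^p for all q >= p, so <f,g_p>
   is also close to 0. *)
Require Import Defs.
From mathcomp Require Import all_boot all_order all_algebra.
From mathcomp Require Import complex.
From mathcomp Require Import all_classical all_reals all_analysis.
From mathcomp Require Import finmap lra.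
From mathcomp.analysis Require showcase.summability.

Set Implicit Arguments.
Unset Strict Implicit.
Unset Printing Implicit Defensive.

Import Order.TTheory GRing.Theory Num.Theory.
Import numFieldNormedType.Exports.
Import showcase.summability.

Local Open Scope classical_set_scope.
Local Open Scope ring_scope.
Local Notation normc := Normc.normc.

(** * The real-valued modulus of complex numbers *)

Section ComplexModulus.
Context {R : realType}.
Implicit Types z w : R[i].

Lemma ltc_norm z (e : R) : (`|z| < e%:C%C) = (normc z < e).
Proof. exact: ltcR. Qed.

Lemma lec_norm z (e : R) : (`|z| <= e%:C%C) = (normc z <= e).
Proof. exact: lecR. Qed.

Lemma normc_ge0 z : 0 <= normc z.
Proof. by case: z => a b; exact: sqrtr_ge0. Qed.

Lemma normc_real (a : R) : normc a%:C%C = `|a|.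
Proof. by rewrite /= expr0n addr0 sqrtr_sqr. Qed.

Lemma Re_le_normc z : `|complex.Re z| <= normc z.
Proof. by case: z => a b /=; rewrite -sqrtr_sqr ler_wsqrtr// lerDl sqr_ge0. Qed.

Lemma Im_le_normc z : `|complex.Im z| <= normc z.
Proof. by case: z => a b /=; rewrite -sqrtr_sqr ler_wsqrtr// lerDr sqr_ge0. Qed.

Lemma normc_le_ReIm z : normc z <= `|complex.Re z| + `|complex.Im z|.
Proof.
case: z => a b /=.
rewrite -[leRHS]ger0_norm ?addr_ge0// -sqrtr_sqr ler_wsqrtr//.
rewrite sqrrD !real_normK ?num_real// lerD2r lerDl.
by rewrite mulrn_wge0// mulr_ge0.
Qed.

Lemma normc_sum (I : Type) (r : seq I) (u : I -> R[i]) :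
  normc (\sum_(i <- r) u i) <= \sum_(i <- r) normc (u i).
Proof.
elim/big_ind2 : _ => [|a b c d ab cd|//]; first by rewrite Normc.normc0.
by rewrite (le_trans (le_normcD _ _))// lerD.
Qed.

End ComplexModulus.

(** * Unordered sums and their tails *)

Section UnorderedSums.
Context {R : realType} {I : choiceType}.
Implicit Types (u : I -> R[i]) (A B : {fset I}) (e : R).

(** Bounds the absolute mass of [u] off [A] through finite sets only, so no infinite sum has to
    exist beforehand. *)
Definition tail_le u A e :=
  forall B, [disjoint A & B]%fset -> \sum_(i <- B) normc (u i) <= e.

(** Absolute summability in Cauchy form. *)
Definition small_tails u := forall e, 0 < e -> exists A, tail_le u A e.

Lemma tail_le_sub u A B e : (A `<=` B)%fset -> tail_le u A e -> tail_le u B e.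
Proof.
move=> AB uA D BD; apply: uA; rewrite -fsetI_eq0 -fsubset0.
by move: BD; rewrite -fsetI_eq0 => /eqP <-; exact: fsetSI.
Qed.

Lemma normc_sum_tail u A B e : tail_le u A e -> (A `<=` B)%fset ->
  normc (\sum_(i <- B) u i - \sum_(i <- A) u i) <= e.
Proof.
move=> uA /fsubsetP AB; rewrite (big_fsetID _ (mem A) B)/=.
have -> : [fset x | x in B & x \in A]%fset = A.
  apply/fsetP => x; rewrite !inE/=.
  by have [/AB->|] := boolP (x \in A); rewrite ?andbT ?andbF.
rewrite addrAC subrr add0r (le_trans (normc_sum _ _))//; apply: uA.
rewrite -fsetI_eq0; apply/eqP/fsetP => x; rewrite !inE/=.
by case: (x \in A); rewrite ?andbF.
Qed.

(** Completeness of [R] is applied to the real and imaginary parts separately: both are additive and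
    bounded by the modulus, so their partial sums form Cauchy nets. *)
Lemma small_tails_cvg u : small_tails u ->
  exists l : R[i], forall e, 0 < e -> exists A, forall B, (A `<=` B)%fset ->
    normc (l - \sum_(i <- B) u i) <= e.
Proof.
move=> stu; have FF := @totally_filter I.
have cvh (h : R[i] -> R) : (forall z w, h (z - w) = h z - h w) ->
    (forall z, `|h z| <= normc z) -> exists l : R, forall e, 0 < e ->
    exists A, forall B, (A `<=` B)%fset -> `|l - h (\sum_(i <- B) u i)| <= e.
  move=> hB hn.
  have : cvg ((fun B => h (\sum_(i <- B) u i)) @ @totally I).
    apply/cauchy_cvgP/cauchyP => e e0.
    have [A uA] := stu _ (divr_gt0 e0 (ltr0n _ 2)).
    exists (h (\sum_(i <- A) u i)), A => // B AB /=.
    rewrite /ball/= distrC -hB (le_lt_trans (hn _))//.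
    rewrite (le_lt_trans (normc_sum_tail uA AB))//; lra.
  move=> /cvg_ex[l /cvgrPdist_le ul]; exists l => e /ul[A _ Al].
  by exists A.
have [lr hr] := cvh (@complex.Re R) (fun z w => raddfB _ _ _) Re_le_normc.
have [li hi] := cvh (@complex.Im R) (fun z w => raddfB _ _ _) Im_le_normc.
exists (lr +i* li)%C => e e0.
have e20 : 0 < e / 2 by rewrite divr_gt0.
have [[A hA] [B hB]] := (hr _ e20, hi _ e20).
exists (A `|` B)%fset => D; rewrite fsubUset => /andP[AD BD].
rewrite (le_trans (normc_le_ReIm _))// (splitr e) lerD//.
  by rewrite raddfB /= hA.
by rewrite raddfB /= hB.
Qed.

(** Partial sums over supersets of [A] stay within [e] of the sum over [A], and the bound passes to
    the limit. *)
Lemma sum_tail u A e : small_tails u -> tail_le u A e ->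
  normc ((sum (u : I -> R[i]^o) : R[i]) - \sum_(i <- A) u i) <= e.
Proof.
move=> stu uA; have [l lu] := small_tails_cvg stu.
have FF := @totally_filter I.
have -> : (sum (u : I -> R[i]^o) : R[i]) = l.
  apply: (@cvg_lim R[i]^o); first exact: norm_hausdorff.
  (* A positive element of [R[i]] has zero imaginary part, so the radius is a real number. *)
  apply/cvgrPdist_le => -[e1 e2]; rewrite ltcE/= => /andP[/eqP-> e10].
  have [B hB] := lu _ e10; exists B => // D /hB.
  by rewrite -lec_norm big_seq_fsetE.
apply/ler_addgt0Pr => d d0; have [B hB] := lu _ d0.
have := hB _ (fsubsetUr A B).
have := normc_sum_tail uA (fsubsetUl A B).
set s := \sum_(i <- A) _; set t := \sum_(i <- _) _ => st lt.
rewrite (_ : l - s = (t - s) + (l - t)); last by rewrite [RHS]addrC subrKA.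
by rewrite (le_trans (le_normcD _ _))// lerD.
Qed.

(** Off [A] the tail bound is [0], so [sum_tail] with [e = 0] gives equality. *)
Lemma sum_finite_support u A : (forall i, i \notin A -> u i = 0) ->
  (sum (u : I -> R[i]^o) : R[i]) = \sum_(i <- A) u i.
Proof.
move=> u0.
have uA : tail_le u A 0.
  move=> B /fdisjointP AB; rewrite big_seq big1// => i iB.
  by rewrite u0 ?Normc.normc0//; apply/negP => /AB; rewrite iB.
apply/eqP; rewrite -subr_eq0; apply/eqP/Normc.eq0_normc/eqP.
rewrite eq_le normc_ge0 andbT; apply: sum_tail => // e e0.
by exists A => B /uA /le_trans; apply; exact: ltW.
Qed.

End UnorderedSums.

(** * Criteria for small tails *)

Section SmallTails.
Context {R : realType} {I : choiceType}.
Implicit Types (u v : I -> R[i]) (A B : {fset I}).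

(** Take [A] whose sum of moduli is within [e] of the supremum: a disjoint [B] of mass above [e]
    would push the sum over the union past that supremum. *)
Lemma bounded_small_tails u (M : R) :
  (forall A, \sum_(i <- A) normc (u i) <= M) -> small_tails u.
Proof.
move=> uM e e0; pose S := [set \sum_(i <- A) normc (u i) | A in [set: {fset I}]].
have ubS : has_ubound S by exists M => _ [A _ <-].
have [|_ [A _ <-] supA] := @sup_adherent _ S _ e0.
  by split => //; exists (\sum_(i <- fset0) normc (u i)), fset0.
exists A => B AB.
have : \sum_(i <- (A `|` B)%fset) normc (u i) <= sup S.
  by apply: ub_le_sup => //; exists (A `|` B)%fset.
(* The library splits sums over disjoint families of finite sets only. *)
have -> : (A `|` B)%fset =
    (\bigcup_(b <- [fset true; false]) if b then A else B)%fset.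
  by rewrite big_fsetU1/= ?inE// big_seq_fset1.
rewrite partition_disjoint_bigfcup; last first.
  by move=> [] []; rewrite ?inE//= => _ _ _; rewrite // fdisjoint_sym.
rewrite big_fsetU1/= ?inE// big_seq_fset1 => ABS.
by rewrite -(lerD2l (\sum_(i <- A) normc (u i))) (le_trans ABS)// -lerBlDr ltW.
Qed.

Lemma tail_le_dominated u v A (e : R) : (forall i, normc (u i) <= normc (v i)) ->
  tail_le v A e -> tail_le u A e.
Proof. by move=> uv vA B /vA; apply: le_trans; exact: ler_sum. Qed.

Lemma small_tails_dominated u v : (forall i, normc (u i) <= normc (v i)) ->
  small_tails v -> small_tails u.
Proof.
move=> uv vt e /vt[A vA]; exists A; exact: tail_le_dominated vA.
Qed.

End SmallTails.

(** * Uniform distributions on finite sets, as elements of the unit ball *)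

Section UniformDistributions.
Context {R : realType}.
Local Notation unit_interval := (set_type `[0%R : R, 1%R]%classic).

Lemma norm1_sum_le (f : unit_interval -> R[i]) (M : R) (A : {fset unit_interval}) :
  (norm1 f <= M%:E)%E -> \sum_(i <- A) normc (f i) <= M.
Proof.
move=> fM; rewrite -lee_fin (le_trans _ fM)// -sumEFin.
apply: esum_ge; exists [set` A]; first by split; [exact: finite_fset|].
rewrite fsbig_finite/=; last exact: finite_fset.
by rewrite set_fsetK.
Qed.

Definition uniform_fun (A : {fset unit_interval}) (y : unit_interval) : R[i] :=
  if y \in A then ((#|` A|%:R)^-1)%:C%C else 0.

Lemma norm1_uniform A : (norm1 (uniform_fun A) <= 1)%E.
Proof.
have -> : norm1 (uniform_fun A) = (\esum_(y in [set` A]) ((#|` A|%:R)^-1)%:E)%E.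
  rewrite esum_mkcond; apply: eq_esum => y _.
  rewrite /uniform_fun mem_setE.
  by case: ifPn => _; rewrite ?Normc.normc0// normc_real ger0_norm.
have finA : finite_set [set` A] by exact: finite_fset.
rewrite esum_fset// fsbig_finite//= set_fsetK sumEFin lee_fin.
rewrite big_const_seq count_predT iter_addr_0 -[leLHS]mulr_natl.
(* For empty [A] the total mass is 0 instead of 1. *)
have [->|A0] := eqVneq #|` A| 0%N; first by rewrite mul0r.
by rewrite divff ?pnatr_eq0.
Qed.

Lemma uniform_l1 A : uniform_fun A \in @l1_pred R.
Proof. by rewrite inE (le_lt_trans (norm1_uniform A))// ltry. Qed.

Definition uniform A : l1 R := L1 (uniform_l1 A).

Lemma pairing_uniform A g :
  (pairing (uniform A) g : R[i]) = ((#|` A|%:R)^-1)%:C%C * \sum_(y <- A) g y.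
Proof.
rewrite /pairing (@sum_finite_support _ _ _ A) => [|y yA]; last first.
  by rewrite /= /uniform_fun (negPf yA) mul0r.
rewrite mulr_sumr big_seq [RHS]big_seq; apply: eq_bigr => y yA.
by rewrite /= /uniform_fun yA.
Qed.

End UniformDistributions.

(** With [j] the least element of [S], all of [S] lies among the [m] integers starting at [j]. *)
Lemma card_set_ord_diam (n m : nat) (S : {set 'I_n}) :
  (forall i j : 'I_n, i \in S -> j \in S -> (i < j + m)%N) -> (#|S| <= m)%N.
Proof.
move=> Sm; have [->|[i0 i0S]] := set_0Vmem S; first by rewrite cards0.
case: (arg_minnP (fun i : 'I_n => val i) i0S) => j jS jmin.
rewrite cardE -(size_map val) -[leqRHS](size_iota j).
apply: uniq_leq_size; first by rewrite (map_inj_uniq val_inj) enum_uniq.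
move=> _ /mapP[i + ->]; rewrite mem_enum => iS.
by rewrite mem_iota jmin//= Sm.
Qed.

(** * Cluster points in a weak topology *)

Section WeakTopology.
Context {K : numFieldType} {V : lmodType K}.

(** The preimage under [l] of a ball around [l f] is a weak neighbourhood of [f], hence meets every
    member of [F]. *)
Lemma weak_cluster_near (D : set (V -> K^o)) (F : set_system V) (f : V)
    (l : V -> K^o) (P : set V) (e : K) :
  @cluster (weak_topology D) F f -> D l -> F P -> 0 < e ->
  exists2 h, P h & `|l f - l h| < e.
Proof.
move=> clf Dl FP e0.
have : nbhs (f : weak_topology D) (l @^-1` ball (l f) e).
  have /cvg_sup/(_ (exist _ l (mem_set Dl))) :
      nbhs (f : weak_topology D) --> (f : weak_topology D).
    exact: cvg_id.
  apply; apply: (@initial_continuous V K^o l f).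
  exact: nbhsx_ballx.
move=> /(clf _ _ FP)[h [Ph]]; rewrite /preimage/= -ball_normE => lh.
by exists h.
Qed.

End WeakTopology.

(** * Dyadic averages and tent functions *)

Section DyadicGrids.
Context {R : realType}.
Local Notation unit_interval := (set_type `[0%R : R, 1%R]%classic).

Lemma dyadic_unit_interval q (k : 'I_(2 ^ q)) :
  (k%:R / 2 ^+ q : R) \in `[0%R : R, 1%R]%classic.
Proof.
apply: mem_set; rewrite /= in_itv/= divr_ge0 ?exprn_ge0//= ler_pdivrMr ?exprn_gt0// mul1r.
by rewrite -natrX ler_nat ltnW.
Qed.

Definition dyadic q (k : 'I_(2 ^ q)) : unit_interval :=
  SigSub (dyadic_unit_interval k).

Lemma dyadic_inj q : injective (@dyadic q).
Proof.
move=> i j [] /(mulIf _) ij; apply/val_inj/eqP; rewrite -(eqr_nat R).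
by apply/eqP/ij; rewrite invr_neq0// expf_neq0.
Qed.

Definition dyadic_grid q : {fset unit_interval} :=
  [fset dyadic k | k in 'I_(2 ^ q)]%fset.

Lemma pairing_dyadic_grid q g :
  (pairing (uniform (dyadic_grid q)) g : R[i]) =
  ((2 ^+ q)^-1)%:C%C * \sum_(k < 2 ^ q) g (dyadic k).
Proof.
rewrite pairing_uniform card_imfset/=; last exact: dyadic_inj.
rewrite big_imfset/=; last by move=> ? ? _ _; exact: dyadic_inj.
by rewrite -cardE card_ord natrX big_enum.
Qed.

Definition tent p (x y : unit_interval) : R :=
  Num.max 0 (1 - 2 ^+ p * `|val y - val x|).

Lemma tent_ge0 p x y : 0 <= tent p x y.
Proof. by rewrite le_max lexx. Qed.

Lemma tent_le1 p x y : tent p x y <= 1.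
Proof. by rewrite ge_max ler01 gerBl mulr_ge0 ?exprn_ge0. Qed.

Lemma tent_center p x : tent p x x = 1.
Proof. by rewrite /tent subrr normr0 mulr0 subr0 max_r. Qed.

Lemma tent_eq0 p x y : 1 <= 2 ^+ p * `|val y - val x| -> tent p x y = 0.
Proof. by move=> ?; rewrite /tent max_l// subr_le0. Qed.

Lemma continuous_real_complex : continuous (fun a : R => a%:C%C : R[i]^o).
Proof.
move=> a; apply/cvgrPdist_lt => -[e1 e2]; rewrite ltcE/= => /andP[/eqP-> e10].
near=> b; rewrite -[X in `|X|]/(a%:C%C - b%:C%C) -raddfB ltc_norm normc_real.
by near: b; exact: cvgr_dist_lt.
Unshelve. all: by end_near. Qed.

Lemma tent_C01 p x : C01 (fun y => (tent p x y)%:C%C).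
Proof.
move=> y; apply: (@continuous_comp _ R _ (tent p x)); last first.
  exact: continuous_real_complex.
(* The tent is the restriction of a continuous function on all of [R]. *)
pose k (t : R) := Num.max 0 (1 - 2 ^+ p * `|t - val x|).
apply: (@continuous_comp _ R R (fun y : unit_interval => val y) k).
  exact: initial_continuous.
apply: continuous_max; first exact: cvg_cst.
apply: cvgB; first exact: cvg_cst.
apply: cvgM; first exact: cvg_cst.
by apply: cvg_norm; apply: cvgB; [exact: cvg_id|exact: cvg_cst].
Qed.

(** The tent is at most 1 and vanishes off an interval of length [2 / 2^p], which contains at most
    [2 * 2^(q-p)] grid points, each of weight [2^-q]. *)
Lemma pairing_dyadic_grid_tent p q x : (p <= q)%N ->
  normc (pairing (uniform (dyadic_grid q)) (fun y => (tent p x y)%:C%C))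
    <= 2 / 2 ^+ p.
Proof.
move=> pq; rewrite pairing_dyadic_grid.
rewrite -(rmorph_sum (real_complex R)) -(rmorphM (real_complex R)) normc_real.
rewrite ger0_norm ?mulr_ge0 ?invr_ge0 ?exprn_ge0 ?sumr_ge0// => [|k _]; last first.
  exact: tent_ge0.
have q0 : 0 < (2 : R) ^+ q by rewrite exprn_gt0.
have p0 : 0 < (2 : R) ^+ p by rewrite exprn_gt0.
(* The length of the support in grid steps; [p <= q] makes it a natural number. *)
have width : 2 ^+ q * (2 / 2 ^+ p) = (2 * 2 ^ (q - p))%:R :> R.
  rewrite natrM natrX -{1}(subnK pq) exprD mulrCA -mulrA.
  by rewrite divff ?mulr1// lt0r_neq0.
pose S := [set k : 'I_(2 ^ q) | `|val (dyadic k) - val x| < (2 ^+ p)^-1]%SET.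
rewrite ler_pdivrMl// (@le_trans _ _ #|S|%:R)//.
  rewrite -sum1_card natr_sum [leRHS]big_mkcond/=; apply: ler_sum => k _.
  case: ifPn => [_|]; first exact: tent_le1.
  rewrite inE -leNgt => kx; rewrite tent_eq0//.
  by rewrite -ler_pdivrMl ?mulr1.
rewrite width ler_nat; apply: card_set_ord_diam => i j; rewrite !inE => ix jx.
have : `|val (dyadic i) - val (dyadic j)| < 2 / 2 ^+ p.
  rewrite -(subrKA (val x)) (le_lt_trans (ler_normD _ _))//.
  by rewrite mulrDl !mul1r ltrD// distrC.
move=> /(le_lt_trans (ler_norm _)); rewrite /dyadic/= -mulrBl ltr_pdivrMr//.
rewrite ltrBlDl mulrC.
by rewrite width -natrD ltr_nat.
Qed.

End DyadicGrids.

(** * Contradiction at a weak cluster point of the averages *)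

Theorem proposition3 (R : realType) (tau : Topological (l1 R))
    (htau : is_mackey_topology (@C01_functionals R) tau) :
  ~ @compact (weak_topology (continuous_dual tau)) (@l1_unit_ball R).
Proof.
case: htau => _ -> _ cpt.
pose F := (fun q => uniform (dyadic_grid (R := R) q)) @ \oo.
have Fball : F (@l1_unit_ball R) by exists 0%N => // q _; exact: norm1_uniform.
have [f [f1 clf]] := cpt F _ Fball.
(* Any tail of the sequence belongs to [F], so [q] can be found beyond any prescribed [p]. *)
have near_cluster (g : set_type `[0%R : R, 1%R]%classic -> R[i]) (e : R) p :
    C01 g -> 0 < e -> exists2 q, (p <= q)%N &
    normc ((pairing f g : R[i]) - pairing (uniform (dyadic_grid q)) g) < e.
  move=> gC e0.
  have FP : F [set uniform (dyadic_grid q) | q in [set q | (p <= q)%N]].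
    by exists p => // q pq; exists q.
  have e0' : 0 < e%:C%C by rewrite ltcR.
  have Dg : C01_functionals (fun h : l1 R => pairing h g) by exists g.
  have [_ [q pq <-]] := weak_cluster_near clf Dg FP e0'.
  by move=> fq; exists q => //; rewrite -ltc_norm.
have ft : small_tails f by apply: (@bounded_small_tails _ _ _ 1) => A; exact: norm1_sum_le f1.
have f_one : (pairing f (fun=> 1) : R[i]) = 1.
  apply/eqP; rewrite -subr_eq0; apply/eqP/Normc.eq0_normc/eqP.
  rewrite eq_le normc_ge0 andbT; apply/ler_addgt0Pr => e e0; rewrite add0r.
  have [|q _] := near_cluster (fun=> 1) e 0%N _ e0; first exact: (@cst_continuous _ R[i]^o).
  rewrite pairing_dyadic_grid sumr_const card_ord -(rmorph_nat (real_complex R)).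
  by rewrite -(rmorphM (real_complex R)) natrX mulVf ?expf_neq0// => /ltW.
have [x fx] : exists x, f x != 0.
  apply/not_existsP => f0.
  have : (pairing f (fun=> 1) : R[i]) = 0.
    rewrite /pairing (@sum_finite_support _ _ _ fset0) ?big_seq_fset0// => i _.
    by have /negP := f0 i; rewrite negbK => /eqP ->; rewrite mul0r.
  by rewrite f_one => /eqP; rewrite oner_eq0.
(* Three errors of size at most [c] will bound [normc (f x) = 4c]. *)
pose c := normc (f x) / 4.
have c0 : 0 < c.
  rewrite divr_gt0// lt_neqAle normc_ge0 andbT eq_sym.
  by apply: contra_neq fx; exact: Normc.eq0_normc.
have [A0 fA0] := ft _ c0.
(* Adding [x] ensures that [f x] occurs in the finite sum. *)
pose A := (x |` A0)%fset.
have fA : tail_le f A c by apply: tail_le_sub fA0; exact: fsubsetUr.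
have [p p_c p_A] : exists2 p, 2 / 2 ^+ p < c &
    forall y, y \in A -> y != x -> 1 <= 2 ^+ p * `|val y - val x|.
  (* [2 / c] makes the tent narrow enough for the averages; the sum dominates each inverse distance,
     so the tent vanishes at the other points of [A]. The term at [y = x] is [0^-1 = 0]. *)
  pose M : R := 2 / c + 1 + \sum_(y <- A) `|val y - val x|^-1.
  have sum0 B : 0 <= \sum_(y <- B) `|val y - val x|^-1.
    by apply: sumr_ge0 => y _; rewrite invr_ge0.
  have c2 : 0 < 2 / c by rewrite divr_gt0.
  have [p Mp] : exists p, M < 2 ^+ p.
    exists (Num.bound M); rewrite (lt_trans (archi_boundP _))//.
      by rewrite /M addr_ge0 ?sum0// addr_ge0// ltW.
    by rewrite -natrX ltr_nat ltn_expl.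
  exists p => [|y yA yx].
    rewrite ltr_pdivrMr ?exprn_gt0// mulrC -ltr_pdivrMr// (le_lt_trans _ Mp)//.
    by rewrite /M -addrA lerDl addr_ge0 ?sum0.
  have yx0 : 0 < `|val y - val x|.
    by rewrite normr_gt0 subr_eq0; apply: contra_neq yx; exact: val_inj.
  rewrite -ler_pdivrMr// mul1r (le_trans _ (ltW Mp))// /M (big_fsetD1 y)//=.
  by rewrite addrCA lerDl addr_ge0 ?sum0// addr_ge0// ltW.
pose g y : R[i] := (tent p x y)%:C%C.
(* The product inherits the tail bound of [f] with the same [A], however narrow the tent is. *)
have fgf y : normc (f y * g y) <= normc (f y).
  rewrite Normc.normcM normc_real ger0_norm ?tent_ge0//.
  by rewrite ler_piMr ?normc_ge0// tent_le1.
have := sum_tail (small_tails_dominated fgf ft) (tail_le_dominated fgf fA).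
(* The sum over [A] reduces to its term at [x], which is [f x]. *)
rewrite -[sum _]/(pairing f g) (big_fsetD1 x) ?inE ?eqxx//= big_seq big1 => [|y].
  rewrite /g tent_center mulr1 addr0 => fgx.
  have [q pq fgq] := near_cluster g c p (@tent_C01 _ p x) c0.
  have gq := pairing_dyadic_grid_tent x pq.
  have : normc (f x) <= normc ((pairing f g : R[i]) - f x) +
      (normc ((pairing f g : R[i]) - pairing (uniform (dyadic_grid q)) g) +
       normc (pairing (uniform (dyadic_grid q)) g)).
    rewrite -(normcN (_ - f x)) opprB.
    rewrite (le_trans _ (lerD (lexx _) (le_normcD _ _)))//.
    by rewrite (le_trans _ (le_normcD _ _))// subrK subrK.
  move: c0 fgx fgq gq p_c; rewrite /c -/g; lra.
rewrite in_fsetD1 => /andP[yx yA].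
by rewrite /g tent_eq0 ?mulr0// p_A.
Qed.
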